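(* Let $\hat G$ be a graph and $\hat A,\hat B\subseteq V(\hat G)$ two sets of cardinality $\hat N>0$ each, such that $\hat G$ has the perfect unique linkage property with respect to $(\hat A,\hat B)$, with unique linkage $\hat{\mathcal R}$. Let $\hat{\mathcal Q}$ be a set of node-disjoint paths in $\hat G$ such that every path of $\hat{\mathcal Q}$ intersects at least one path of $\hat{\mathcal R}$, and let $\hat M,\hat w>0$ be integers with $|\hat{\mathcal Q}|\geq \hat M\hat w+(\hat M+1)\hat N$. Then there is an $\hat M$-slicing of $\hat{\mathcal R}$ of width at least $\hat w$ with respect to $\hat{\mathcal Q}$.
   Context: For $Y,Z\subseteq V(\hat G)$ with $|Y|=|Z|=r$, $\hat G$ has the unique linkage property with respect to $(Y,Z)$ if there is exactly one set of $r$ node-disjoint paths in $\hat G$ connecting every vertex of $Y$ to a distinct vertex of $Z$ (a $(Y,Z)$-linkage); it has the perfect unique linkage property if additionally every vertex of $\hat G$ lies on a path of this unique linkage. Each path $R\in\hat{\mathcal R}$ is oriented from its endpoint $a(R)\in\hat A$ (first endpoint) to its endpoint $b(R)\in\hat B$ (last endpoint). An $\hat M$-slicing $\Lambda$ of $\hat{\mathcal R}$ assigns to each $R\in\hat{\mathcal R}$ a sequence $(v_0(R),\ldots,v_{\hat M}(R))$ of vertices of $R$ appearing on $R$ in this order (repetitions allowed) with $v_0(R)=a(R)$, $v_{\hat M}(R)=b(R)$. For $1\le i\le\hat M$, $\sigma_i(R)$ is the sub-path of $R$ strictly between $v_{i-1}(R)$ and $v_i(R)$ (excluding both; possibly empty),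 $\Sigma_i=\{\sigma_i(R)\mid R\in\hat{\mathcal R}\}$, and $\hat{\mathcal Q}_i$ is the set of paths $Q\in\hat{\mathcal Q}$ such that every vertex of $Q$ lying on a path of $\hat{\mathcal R}$ belongs to $\bigcup_{\sigma\in\Sigma_i}\sigma$. The width of $\Lambda$ with respect to $\hat{\mathcal Q}$ is $\min_{1\le i\le \hat M}|\hat{\mathcal Q}_i|$. Two paths intersect if they share a vertex. *)

(* Defs.v *)
From mathcomp Require Import all_boot.
From mathcomp Require Import finmap.

Set Implicit Arguments.
Unset Strict Implicit.
Unset Printing Implicit Defensive.

Local Open Scope fset_scope.

Section Graph.
(* A finite simple graph is a symmetric irreflexive relation e on the finite
   vertex type T; a path is the nonempty duplicate-free sequence of its
   vertices. *)
Variables (T : finType) (e : rel T).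
Implicit Types (p q : seq T) (P RR : {fset seq T}) (Y Z : {set T}).

Definition is_path p : bool :=
  if p is x :: q then path e x q && uniq p else false.

Definition connects p (y z : T) : Prop :=
  is_path p /\ ohead p = Some y /\ last y p = z.

Definition intersects p q : bool := has [in q] p.

(* Since paths are nonempty, a node-disjoint set never contains both a path
   and its (different) reversal, so its cardinal counts undirected paths. *)
Definition node_disjoint_paths P : Prop :=
  {in P, forall p, is_path p} /\
  {in P &, forall p q, p != q -> ~~ intersects p q}.

Definition vertices_of P : {set T} := \bigcup_(p <- P) [set x in p].

(* The paths are stored oriented from Y to Z.  By node-disjointness, distinct
   paths have distinct endpoints in Z, and the orientation is forced even when
   Y and Z meet (a common vertex is then a one-vertex path). *)
Definition linkage Y Z P : Prop :=
  [/\ #|` P| = #|Y|,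
      node_disjoint_paths P,
      {in P, forall p, exists y z, [/\ y \in Y, z \in Z & connects p y z]} &
      {in Y, forall y, exists2 p, p \in P & exists2 z, z \in Z & connects p y z}].

Definition unique_linkage Y Z RR : Prop :=
  linkage Y Z RR /\ forall P, linkage Y Z P -> P = RR.

Definition perfect_unique_linkage Y Z RR : Prop :=
  unique_linkage Y Z RR /\ vertices_of RR = [set: T].

End Graph.

Section Slicing.
(* v R i is the vertex v_i(R); only R \in RR and i <= M are relevant. *)
Variables (T : finType) (M : nat) (RR : {fset seq T}) (v : seq T -> nat -> T).
Implicit Types (R Q : seq T) (QQ : {fset seq T}).

(* R is duplicate-free, so index x R is the position of x on R. *)
Definition is_slicing : Prop :=
  {in RR, forall R,
    [/\ forall i, i <= M -> v R i \in R,
        forall i, i < M -> index (v R i) R <= index (v R i.+1) R,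
        ohead R = Some (v R 0) &
        last (v R 0) R = v R M]}.

Definition sigma i R : seq T :=
  [seq x <- R | index (v R i.-1) R < index x R < index (v R i) R].

Definition Sigma i : {fset seq T} := [fset sigma i R | R in RR].

Definition slice QQ i : {fset seq T} :=
  [fset Q in QQ |
    [set x in Q] :&: vertices_of RR \subset vertices_of (Sigma i)].

(* Every slice is a subset of QQ, so for M > 0 the default value #|` QQ| does
   not affect the minimum. *)
Definition width QQ : nat :=
  \big[minn/#|` QQ|]_(1 <= i < M.+1) #|` slice QQ i|.

End Slicing.

(* Main.v *)
Require Import Defs.
From mathcomp Require Import all_boot.
From mathcomp Require Import finmap.
From mathcomp Require Import zify.

(* Let s x be the vertex following x on its path of the linkage, closed up to a
   cycle so that s is a permutation mapping B onto A.  For x, y outside of B put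
   x -> y when y <> x and either s y = x or x is adjacent to s y.
   On a cycle of -> each s x can be replaced by s y, which yields a second
   linkage; hence -> is acyclic.  A set S of vertices outside of B that is closed
   under -> meets each path in a prefix, and the at most N vertices following
   these prefixes separate S from the rest of the graph.
   Growing S one vertex at a time from the empty set to the complement of B,
   the number of paths of QQ inside S grows by at most 1 at each step and ends
   at |QQ| - N or more, so it takes every value i (w + N) with i <= M.  Slicing
   at the corresponding cuts leaves at least w paths in each slice, because at
   most N paths of QQ meet a given cut. *)

Set Implicit Arguments.
Unset Strict Implicit.
Unset Printing Implicit Defensive.

Local Open Scope fset_scope.

(** * Node-disjoint paths met by a vertex set *)

Section PathThrough.
Variables (T : finType) (e : rel T).
Implicit Types (P : {fset seq T}) (p : seq T).

Definition path_through P (x : T) : seq T := nth [::] P (find (fun p => x \in p) P).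

Lemma path_throughE P p x :
  node_disjoint_paths e P -> p \in P -> x \in p -> path_through P x = p.
Proof.
move=> [_ disjP] pP xp.
have has_p : has (fun p => x \in p) P by apply/hasP; exists p.
have qP : path_through P x \in P by rewrite /path_through mem_nth // -has_find.
have xq : x \in path_through P x by exact: (nth_find [::] has_p).
apply/eqP/negPn/negP => neq.
have /negP := disjP _ _ qP pP neq; apply.
by apply/hasP; exists x.
Qed.

(** By disjointness, a path is determined by any of its vertices in [C]. *)
Lemma card_touching P (C : {set T}) :
  node_disjoint_paths e P -> #|` [fset p in P | has [in C] p]| <= #|C|.
Proof.
move=> ndP.
have sub : [fset p in P | has [in C] p] `<=` [fset path_through P x | x in C].
  apply/fsubsetP => p; rewrite !inE /= => /andP[pP /hasP[x xp xC]].
  by apply/imfsetP; exists x => //; rewrite (path_throughE ndP pP xp).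
apply: leq_trans (fsubset_leq_card sub) _.
by rewrite cardE; apply: leq_imfset_card.
Qed.

End PathThrough.

(** * Linkages traced by iterating an injection *)

Section IteratedLinkage.
Variables (T : finType) (e : rel T) (A B : {set T}) (s : T -> T).
Hypotheses (s_inj : injective s) (sB : forall x, (s x \in A) = (x \in B)).
Hypothesis (s_edge : forall x, x \notin B -> s x = x \/ e x (s x)).

(** The orbit of [a] is a cycle; its last vertex is sent back to [a], which is in [A], so that
    vertex is in [B]. *)
Lemma exit_exists a : a \in A -> exists n, iter n s a \in B.
Proof.
move=> aA; exists (order s a).-1.
by rewrite -sB -iterS orderSpred iter_order.
Qed.

(** [insub] supplies the membership proof that [exit_exists] needs; the value 0 outside of [A] is a
    dummy. *)
Definition exit_time a : nat :=
  if insub a : {? x | x \in A} is Some u then ex_minn (exit_exists (valP u)) else 0.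

Lemma exit_timeP a : a \in A ->
  iter (exit_time a) s a \in B /\ forall n, n < exit_time a -> iter n s a \notin B.
Proof.
move=> aA; rewrite /exit_time insubT; case: ex_minnP => n nB nmin; split=> // m lt_mn.
by apply/negP => /nmin; rewrite leqNgt lt_mn.
Qed.

Definition exit_path a : seq T := traject s a (exit_time a).+1.

(** Cancelling [i] steps makes [a] the iterate of [b] at time [j - i]. If that time were positive,
    the preceding iterate would be in [B], before the exit time of [b]. *)
Lemma iter_meet a b i j : a \in A -> b \in A -> i <= j -> j <= exit_time b ->
  iter i s a = iter j s b -> a = b /\ i = j.
Proof.
move=> aA bA le_ij le_j eq_ij.
have eq_a : a = iter (j - i) s b.
  have inj_i : injective (iter i s) by elim: (i) => //= n IH x y /s_inj /IH.
  by apply: inj_i; rewrite -iterD subnKC.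
case def_k: (j - i) eq_a => [|k] /= eq_a; first by split=> //; lia.
have [_ /(_ k)] := exit_timeP bA.
by rewrite -sB -eq_a aA; move=> /(_ ltac:(lia)).
Qed.

Lemma exit_path_uniq a : a \in A -> uniq (exit_path a).
Proof.
move=> aA; apply/(uniqP a) => i j; rewrite !inE size_traject => lti ltj.
rewrite !nth_traject //; case: (leqP i j) => [le|/ltnW le] eq_ij.
  by have [] := iter_meet aA aA le ltj eq_ij.
by have [] := iter_meet aA aA le lti (esym eq_ij).
Qed.

Lemma exit_path_is_path a : a \in A -> is_path e (exit_path a).
Proof.
move=> aA; have Ua := exit_path_uniq aA.
rewrite /exit_path /= in Ua *; rewrite [X in _ && X]Ua andbT.
apply/(pathP a) => i; rewrite size_traject => lti.
rewrite -[a :: _]/(exit_path a).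
have -> : nth a (traject s (s a) (exit_time a)) i = nth a (exit_path a) i.+1 by [].
have [_ /(_ _ lti) nB] := exit_timeP aA.
have Ei: nth a (exit_path a) i = iter i s a by rewrite nth_traject // ltnW.
have Ei1: nth a (exit_path a) i.+1 = s (iter i s a) by rewrite nth_traject.
(* A fixed point would repeat a vertex at positions [i] and [i.+1]. *)
case: (s_edge nB) => [fix_i|]; last by rewrite Ei Ei1.
have /eqP := etrans Ei1 (etrans fix_i (esym Ei)).
by by rewrite nth_uniq ?size_traject ?ltnS ?(ltnW lti) // (gtn_eqF (ltnSn i)).
Qed.

Lemma exit_path_connects a : a \in A ->
  iter (exit_time a) s a \in B /\ connects e (exit_path a) a (iter (exit_time a) s a).
Proof.
move=> aA; have [inB _] := exit_timeP aA; split=> //; split.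
  exact: exit_path_is_path.
by split=> //; rewrite /exit_path /= last_traject.
Qed.

Lemma exit_path_meet a b x :
  a \in A -> b \in A -> x \in exit_path a -> x \in exit_path b -> a = b.
Proof.
move=> aA bA /trajectP[i lti ->] /trajectP[j ltj].
case: (leqP i j) => [le|/ltnW le] eq_ij.
  by have [] := iter_meet aA bA le ltj eq_ij.
by have [] := iter_meet bA aA le lti (esym eq_ij).
Qed.

Definition exit_paths : {fset seq T} := [fset exit_path a | a in A].

Lemma exit_paths_linkage : linkage e A B exit_paths.
Proof.
have path_head a : a \in exit_path a by rewrite /exit_path /= mem_head.
split.
- rewrite card_in_imfset /= -?cardE // => a b aA bA eq_ab.
  by apply: (exit_path_meet (x := a) aA bA) => //; rewrite -eq_ab.
- split=> [_ /imfsetP[a aA ->]|]; first exact: exit_path_is_path.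
  move=> _ _ /imfsetP[a aA ->] /imfsetP[b bA ->] neq; apply/negP => /hasP[x xa xb].
  by case/eqP: neq; rewrite (exit_path_meet aA bA xa xb).
- move=> _ /imfsetP[a aA ->]; have [inB con] := exit_path_connects aA.
  by exists a, (iter (exit_time a) s a).
- move=> a aA; have [inB con] := exit_path_connects aA.
  exists (exit_path a); first by apply/imfsetP; exists a.
  by exists (iter (exit_time a) s a).
Qed.

Lemma exit_paths_fpath R : R \in exit_paths ->
  if R is a :: q then fpath s a q else false.
Proof. by move=> /imfsetP[a aA ->] /=; apply: fpath_traject. Qed.

End IteratedLinkage.

(** * The successor permutation of the linkage *)

Section Successor.
Variables (T : finType) (e : rel T) (A B : {set T}) (RR : {fset seq T}).
Hypotheses (card_AB : #|A| = #|B|) (RR_link : perfect_unique_linkage e A B RR).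

Let RR_disj : node_disjoint_paths e RR.
Proof. by case: RR_link => -[[]]. Qed.

Let path_eq p q x : p \in RR -> q \in RR -> x \in p -> x \in q -> p = q.
Proof.
move=> pRR qRR xp xq.
by rewrite -(path_throughE RR_disj pRR xp) (path_throughE RR_disj qRR xq).
Qed.

Lemma mem_vertices_of (P : {fset seq T}) x :
  reflect (exists2 p, p \in P & x \in p) (x \in vertices_of P).
Proof.
rewrite /vertices_of; apply: (iffP idP) => [|[p pP xp]].
  rewrite big_seq; elim/big_rec: _ => [|p U pP IH]; first by rewrite inE.
  by rewrite in_setU => /orP[|/IH//]; rewrite inE => xp; exists p.
by rewrite (big_rem p) //= in_setU inE xp.
Qed.

Lemma mem_path_through x : path_through RR x \in RR /\ x \in path_through RR x.
Proof.
have: x \in vertices_of RR by rewrite RR_link.2 inE.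
by move=> /mem_vertices_of[p pRR xp]; rewrite (path_throughE RR_disj pRR xp).
Qed.

(* The last vertices of the paths form an injective family of |A| = |B|
   vertices of B, hence exhaust B. *)
Lemma linkage_path_end x : x \in B -> exists a q, a :: q \in RR /\ last a q = x.
Proof.
move=> xB; have [[[card_RR _ RR_ends _] _] _] := RR_link.
have ends R : R \in RR -> last x R \in R /\ last x R \in B.
  move=> RR_R; have [y [z [_ zB [pathR [_ lastR]]]]] := RR_ends R RR_R.
  case: R {RR_R} pathR lastR => //= b q _ lastR.
  by rewrite mem_last lastR.
pose E := [fset last x R | R in RR].
have card_E : #|` E| = #|` [fset y in B]|.
  rewrite card_in_imfset /=; first by rewrite card_RR card_AB card_finset.
  move=> p q pRR qRR /= eq_last; apply: (path_eq pRR qRR (ends p pRR).1).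
  by rewrite eq_last (ends q qRR).1.
have sub_E : E `<=` [fset y in B].
  by apply/fsubsetP => _ /imfsetP[R /= RR_R ->]; rewrite inE (ends R RR_R).2.
have: x \in E.
  have /eqP -> : E == [fset y in B] by rewrite eqEfcard sub_E card_E leqnn.
  by rewrite inE.
case/imfsetP => R /= RR_R; have [_ [_ [_ _ [pathR _]]]] := RR_ends R RR_R.
by case: R pathR RR_R => //= a q _ RR_R ->; exists a, q.
Qed.

(** Each vertex of [A] starts a path of [RR] and each vertex of [B] ends one, so by disjointness [R]
    meets [A] and [B] only in its endpoints. *)
Lemma linkage_path_shape R : R \in RR -> exists a q,
  [/\ R = a :: q, path e a q, uniq (a :: q),
      {in R, forall x, (x \in A) = (x == a)} &
      {in R, forall x, (x \in B) = (x == last a q)}].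
Proof.
move=> RR_R; have [[[_ _ RR_ends RR_starts] _] _] := RR_link.
have [a [b [aA bB [pathR [headR lastR]]]]] := RR_ends R RR_R.
case: R RR_R pathR headR lastR => // c q RR_R /andP[pathR uniqR] [eq_c] /= lastR.
rewrite {c}eq_c in RR_R pathR uniqR lastR *.
exists a, q; split=> // x xR.
- apply/idP/eqP => [xA | -> //].
  have [p RRp [z _ [_ [headp _]]]] := RR_starts x xA.
  case: p headp RRp => // _ p [->] RRp.
  by have [->] := path_eq RR_R RRp xR (mem_head x p).
- apply/idP/eqP => [xB | ->]; last by rewrite lastR.
  have [c [p [RRp lastp]]] := linkage_path_end xB.
  have xp : x \in c :: p by rewrite -lastp mem_last.
  by have [-> ->] := path_eq RR_R RRp xR xp.
Qed.

Definition successor x := next (path_through RR x) x.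

Lemma successor_inj : injective successor.
Proof.
move=> x y eq_s.
have [RRx xx] := mem_path_through x; have [RRy yy] := mem_path_through y.
have eq_p : path_through RR x = path_through RR y.
  apply: (path_eq RRx RRy (x := successor x)); first by rewrite mem_next.
  by rewrite eq_s mem_next.
move: eq_s; rewrite /successor -eq_p => /(congr1 (prev (path_through RR x))).
have [a [q [-> _ uniqR _ _]]] := linkage_path_shape RRx.
by rewrite !prev_next.
Qed.

Lemma successor_nth a q i : a :: q \in RR -> i < size q ->
  successor (nth a (a :: q) i) = nth a q i.
Proof.
move=> RR_R lti; have inR : nth a (a :: q) i \in a :: q by rewrite mem_nth // ltnW.
rewrite /successor (path_throughE RR_disj RR_R inR) next_nth inR.
have [_ [_ [[<- <-] _ uniqR _ _]]] := linkage_path_shape RR_R.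
by rewrite index_uniq // ltnW.
Qed.

Lemma successor_last a q : a :: q \in RR -> successor (last a q) = a.
Proof.
move=> RR_R.
rewrite /successor (path_throughE RR_disj RR_R (mem_last a q)) next_nth mem_last.
have [_ [_ [[<- <-] _ uniqR _ _]]] := linkage_path_shape RR_R.
by rewrite (last_nth a) index_uniq // nth_default.
Qed.

Lemma successor_startE x : (successor x \in A) = (x \in B).
Proof.
have [RRx xx] := mem_path_through x.
have [a [q [eqR _ uniqR RA RB]]] := linkage_path_shape RRx.
rewrite eqR in RRx xx RA RB; rewrite RB //.
have [i lti <-] := nthP a xx; move: lti; rewrite ltnS leq_eqVlt => /predU1P[->|lti].
  by rewrite -last_nth successor_last // eqxx RA ?mem_head ?eqxx.
rewrite successor_nth // RA ?inE ?mem_nth ?orbT //.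
rewrite (last_nth a) nth_uniq ?ltnS // 1?ltnW //.
(* If the successor of a vertex before the last were [a], then [a] would occur again in [q]. *)
rewrite (ltn_eqF lti); apply: contraTF uniqR => /eqP <-.
by rewrite /= mem_nth.
Qed.

Lemma successor_edge x : x \notin B -> e x (successor x).
Proof.
have [RRx xx] := mem_path_through x.
have [a [q [eqR pathR uniqR _ RB]]] := linkage_path_shape RRx.
rewrite eqR in RRx xx RB; rewrite RB //.
have [i lti <-] := nthP a xx; move: lti; rewrite ltnS leq_eqVlt => /predU1P[->|lti].
  by rewrite -last_nth eqxx.
by move=> _; rewrite successor_nth //; apply: (pathP a pathR).
Qed.

(* Following s from A until B is met traces a linkage, which skips the fixed
   points of s and its cycles disjoint from A.  By uniqueness it is RR, and RR
   covers T, so nothing is skipped and s agrees with the successor. *)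
Lemma successor_unique (s : T -> T) :
  injective s -> (forall x, (s x \in A) = (x \in B)) ->
  (forall x, x \notin B -> s x = x \/ e x (s x)) ->
  forall x, x \notin B -> s x = successor x.
Proof.
move=> s_inj sB s_edge x xB.
have eqRR := RR_link.1.2 _ (exit_paths_linkage s_inj sB s_edge).
have [RRx xx] := mem_path_through x.
have [a [q [eqR pathR uniqR _ RB]]] := linkage_path_shape RRx.
rewrite eqR in RRx xx RB; rewrite RB // in xB.
have := RRx; rewrite -eqRR => /exit_paths_fpath /(pathP a) spath.
have [i lti def_x] := nthP a xx; rewrite -def_x in xB *.
move: lti; rewrite ltnS leq_eqVlt => /predU1P[eq_i|lti].
  by rewrite eq_i -last_nth eqxx in xB.
by rewrite successor_nth //; apply/eqP/spath.
Qed.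

End Successor.

(** * Lower sets and their cuts *)

Section Cuts.
Variables (T : finType) (e : rel T) (A B : {set T}) (s : T -> T).
Hypotheses (e_sym : symmetric e) (s_inj : injective s).
Hypothesis (sB : forall x, (s x \in A) = (x \in B)).
Hypothesis (s_edge : forall x, x \notin B -> e x (s x)).
Hypothesis (s_unique : forall s' : T -> T,
  injective s' -> (forall x, (s' x \in A) = (x \in B)) ->
  (forall x, x \notin B -> s' x = x \/ e x (s' x)) ->
  forall x, x \notin B -> s' x = s x).

(* Otherwise some h maps U to itself, without fixed points, so that x may be
   followed by s (h x) instead of s x.  On a minimal nonempty h-stable set h is
   a permutation, and rerouting there contradicts the uniqueness of s. *)
Lemma exists_extremal (U : {set T}) : U \subset ~: B -> U != set0 ->
  exists2 x, x \in U &
    forall y, y \in U -> y != x -> ~~ ((s y == x) || e x (s y)).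
Proof.
move=> /subsetP UB U0.
case: (boolP [exists x in U,
    [forall y in U, (y != x) ==> ~~ ((s y == x) || e x (s y))]]).
  case/exists_inP=> x xU /forall_inP xP; exists x => // y yU neq.
  by have /implyP := xP y yU; apply.
move=> /exists_inPn noext; exfalso.
pose h x := odflt x [pick y in U | (y != x) && ((s y == x) || e x (s y))].
have hP x : x \in U -> [/\ h x \in U, h x != x & (s (h x) == x) || e x (s (h x))].
  move=> xU; rewrite /h; case: pickP => [y /and3P[] // | none].
  have /negP[] := noext x xU; apply/forall_inP => y yU; apply/implyP => neq.
  by have := none y; rewrite /= yU neq /= => ->.
pose stable (K : {set T}) := [&& K != set0, K \subset U & h @: K \subset K].
have stableU : stable U.
  rewrite /stable U0 subxx; apply/subsetP => _ /imsetP[x xU ->].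
  by have [] := hP x xU.
have [K minK _] := minset_exists stableU.
have /and3P[K0 /subsetP KU hKK] := minsetp minK.
(* [h @: K] is stable too, so minimality gives equality; a map of a finite set onto itself is
   injective. *)
have hK : h @: K = K.
  apply: (minsetinf minK) => //; apply/and3P; split.
  - by rewrite imset_eq0.
  - by apply: subset_trans hKK _; apply/subsetP.
  - exact: imsetS.
have h_inj : {in K &, injective h} by apply/imset_injP; rewrite hK.
have hinK x : x \in K -> h x \in K by move=> xK; rewrite -hK imset_f.
pose g x := if x \in K then h x else x.
have gK x : (g x \in K) = (x \in K) by rewrite /g; case: ifP => [/hinK|].
have g_inj : injective g.
  move=> x y eq_g; have := gK x; rewrite eq_g gK => eqK.
  by move: eq_g; rewrite /g eqK; case: ifP => // xK; apply: h_inj; rewrite ?eqK.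
have KB x : x \in K -> (x \in B) = false.
  by move=> /KU /UB; rewrite inE => /negbTE.
have [x xK] := set0Pn _ K0.
have xB : x \notin B by rewrite KB.
suff : s (g x) = s x.
  by move=> /s_inj /eqP; rewrite /g xK; apply/negP; have [] := hP x (KU x xK).
apply: (s_unique (s' := s \o g)) => // [|y|y yB /=]; first exact: inj_comp.
  by rewrite /= sB /g; case: ifP => // yK; rewrite !KB ?hinK.
rewrite /g; case: ifP => yK; last by right; apply: s_edge.
by have [_ _ /orP[/eqP|]] := hP y (KU y yK); [left | right].
Qed.

(** Closure under the relation [->]; the case [y = x] can be allowed because it demands nothing. *)
Definition lower_set (S : {set T}) : Prop :=
  S \subset ~: B /\
  forall x y, x \in S -> y \notin B -> (s y == x) || e x (s y) -> y \in S.

Lemma lower_set0 : lower_set set0.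
Proof. by split=> [|x y]; rewrite ?sub0set ?inE. Qed.

Lemma lower_setC : lower_set (~: B).
Proof. by split=> // x y _; rewrite inE. Qed.

(** An extremal vertex of [~: B :\: S] has no arrow to another vertex of that set, so adding it
    keeps [S] closed. *)
Lemma lower_set_extend S : lower_set S -> S != ~: B ->
  exists2 x, x \notin S & lower_set (x |: S).
Proof.
move=> [SB Slow] neq.
have [||x] := @exists_extremal (~: B :\: S).
- exact: subsetDl.
- by apply: contraNneq neq => /eqP; rewrite setD_eq0 eqEsubset SB.
rewrite !inE => /andP[xS xB] xP; exists x => //; split.
  by rewrite subUset SB sub1set inE xB.
move=> z y; rewrite !inE => /predU1P[-> | zS] yB zy; last first.
  by rewrite (Slow z y) ?orbT.
apply: contraLR zy; rewrite negb_or => /andP[neq_yx yS].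
by apply: xP; rewrite // !inE yS.
Qed.

(** A discrete intermediate value argument: adding single vertices leads from [S] to [~: B], and [g]
    cannot jump over [k]. *)
Lemma lower_set_interpolation (g : {set T} -> nat) :
  (forall (S : {set T}) x, x \notin S -> g (x |: S) <= (g S).+1) ->
  forall S k, lower_set S -> g S <= k <= g (~: B) ->
  exists S', [/\ lower_set S', S \subset S' & g S' = k].
Proof.
move=> g_step S k; have [n] := ubnP #|~: S|.
elim: n S => // n IH S; rewrite ltnS => le_n lowS /andP[le_k le_B].
have [<- | neq_k] := eqVneq (g S) k; first by exists S.
have neq_SB : S != ~: B by apply: contraNneq neq_k => eqS; rewrite eqn_leq le_k eqS.
have [x xS lowxS] := lower_set_extend lowS neq_SB.
have lt_k : g (x |: S) <= k.
  by apply: leq_trans (g_step S x xS) _; rewrite ltn_neqAle neq_k.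
have [|||S' [lowS' sub_S' gS']] := IH (x |: S).
- apply: leq_trans le_n; apply: proper_card; rewrite properC; apply/properP.
  by split; [apply: subsetUr | exists x; rewrite // !inE eqxx].
- exact: lowxS.
- by apply/andP; split.
by exists S'; split=> //; apply: subset_trans sub_S'; apply: subsetUr.
Qed.

(* The first vertices outside of S on the paths of the linkage. *)
Definition cut (S : {set T}) : {set T} := (A :|: s @: S) :\: S.

(** The preimage of a vertex [x] of [S] under [s] is either in [B], so that [x] is in [A], or in [S]
    by closure. *)
Lemma lower_set_cover S : lower_set S -> S \subset A :|: s @: S.
Proof.
move=> [_ Slow]; apply/subsetP => x xS; rewrite inE.
have [f _ fK] := injF_bij s_inj; rewrite -(fK x) in xS *.
move: (f x) xS => y xS; rewrite sB; case: (boolP (y \in B)) => //= yB.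
by apply: imset_f; apply: Slow xS yB _; rewrite eqxx.
Qed.

Lemma card_cut S : lower_set S -> #|cut S| <= #|A|.
Proof.
move=> lowS; rewrite /cut cardsD (setIidPr (lower_set_cover lowS)) leq_subLR.
rewrite addnC; apply: leq_trans (leq_card_setU _ _) _.
by rewrite leq_add2l leq_imset_card.
Qed.

(** Suppose an edge leaves [S] at [x] and ends in [y] outside of [A]. The predecessor of [y] is then
    not in [B], and closure puts it in [S]; hence [y] is in the cut. *)
Lemma cut_separates S x y : lower_set S -> x \notin cut S -> y \notin cut S ->
  e x y -> (x \in S) = (y \in S).
Proof.
move=> lowS; wlog suff main : x y / x \in S -> y \notin cut S -> e x y -> y \in S.
  move=> xC yC xy; apply/idP/idP => [xS | yS]; first exact: main xS yC xy.
  by apply: main yS xC _; rewrite e_sym.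
move=> xS; rewrite !inE; case: (boolP (y \in S)) => //= yS.
have [f _ fK] := injF_bij s_inj.
rewrite -(fK y) sB; case: (boolP (f y \in B)) => //= fyB.
move=> /imsetP fyS xy; case: fyS.
exists (f y); rewrite ?fK //; apply: lowS.2 xS fyB _.
by rewrite xy orbT.
Qed.

Lemma path_misses_cut S p : lower_set S -> is_path e p -> ~~ has [in cut S] p ->
  has [in S] p -> all [in S] p.
Proof.
move=> lowS; case: p => // a q /= /andP[pathp _].
elim: q a pathp => [|b q IH] a /=; first by rewrite !orbF andbT.
move=> /andP[ab pathp]; rewrite !negb_or => /and3P[aC bC qC].
have /= := IH b pathp; rewrite negb_or bC qC => /(_ isT).
rewrite (cut_separates lowS aC bC ab) => IHb.
by rewrite orbA orbb => /IHb /andP[-> ->].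
Qed.

End Cuts.

(** * Slicing along a chain of lower sets *)

Lemma index_lt_count (T : eqType) (P : pred T) (s : seq T) :
  sorted (fun x y => P y ==> P x) s ->
  {in s, forall x, (index x s < count P s) = P x}.
Proof.
have tr : transitive (fun x y => P y ==> P x).
  by move=> y x z /implyP Pyx /implyP Pzy; apply/implyP => /Pzy.
elim: s => // a s IH sorted_s x; rewrite inE /= => xs.
(* [P] holds on a prefix, so if it fails at the head it fails everywhere. *)
case Pa: (P a); last first.
  have noP : {in s, forall y, P y = false}.
    move=> y ys; have /allP/(_ y ys) := order_path_min tr sorted_s.
    by rewrite Pa implybF => /negbTE.
  have -> : count P s = 0 by rewrite (eq_in_count (a2 := pred0)) ?count_pred0.
  by rewrite ltn0; case/predU1P: xs => [->|/noP].
have [<- | neq] := eqVneq a x; first by rewrite Pa.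
rewrite ltnS IH //; first exact: path_sorted sorted_s.
by move: xs; rewrite eq_sym (negbTE neq).
Qed.

Lemma count_all_but_last (T : eqType) (P : pred T) a (q : seq T) :
  uniq (a :: q) -> {in a :: q, forall x, P x = (x != last a q)} ->
  count P (a :: q) = size q.
Proof.
move=> uniqR PE; rewrite (eq_in_count PE); apply: succn_inj.
rewrite -[RHS]/(size (a :: q)) -(count_predC (pred1 (last a q)) (a :: q)).
by rewrite count_uniq_mem // mem_last.
Qed.

Section CutSlicing.
Variables (T : finType) (e : rel T) (A B : {set T}) (RR : {fset seq T}).
Hypotheses (e_sym : symmetric e) (card_AB : #|A| = #|B|).
Hypothesis RR_link : perfect_unique_linkage e A B RR.
Variables (M : nat) (S : nat -> {set T}) (x0 : T).
Local Notation s := (successor RR).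
Hypotheses (S_lower : forall i, i <= M -> lower_set e B s (S i)).
Hypotheses (S0 : S 0 = set0) (SM : S M = ~: B).
Hypothesis (S_sub : forall i, i < M -> S i \subset S i.+1).

(** As [S i] meets a path of [RR] in a prefix, this is the first vertex of [R] outside of [S i]. The
    default [x0] is never reached there, since the last vertex of [R] is in [B]. *)
Definition cut_slicing (R : seq T) (i : nat) : T := nth x0 R (count [in S i] R).

Lemma lower_set_prefix U R : R \in RR -> lower_set e B s U ->
  {in R, forall x, (index x R < count [in U] R) = (x \in U)}.
Proof.
move=> RR_R lowU; apply: index_lt_count.
have [a [q [eqR _ uniqR _ RB]]] := linkage_path_shape card_AB RR_link RR_R.
rewrite eqR in RR_R RB *; apply/(pathP a) => i lti; apply/implyP => inU.
apply: lowU.2 inU _ _; last by rewrite (successor_nth card_AB RR_link RR_R lti) eqxx.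
rewrite RB ?mem_nth ?ltnS ?(ltnW lti) // (last_nth a) nth_uniq ?ltnS ?(ltnW lti) //.
by rewrite (ltn_eqF lti).
Qed.

Lemma count_lower_set U R : R \in RR -> lower_set e B s U ->
  count [in U] R < size R.
Proof.
move=> RR_R lowU; rewrite ltn_neqAle count_size andbT -all_count.
have [a [q [eqR _ uniqR _ RB]]] := linkage_path_shape card_AB RR_link RR_R.
have lastR : last a q \in R by rewrite eqR mem_last.
have lastB : last a q \in B by rewrite RB.
apply/negP => /allP /(_ _ lastR) /= /(subsetP lowU.1).
by rewrite inE lastB.
Qed.

Lemma index_cut_slicing R i : R \in RR -> i <= M ->
  index (cut_slicing R i) R = count [in S i] R.
Proof.
move=> RR_R lei; rewrite index_uniq ?(count_lower_set RR_R (S_lower lei)) //.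
by have [a [q [-> _ ? _ _]]] := linkage_path_shape card_AB RR_link RR_R.
Qed.

Lemma cut_slicingP : is_slicing M RR cut_slicing.
Proof.
move=> R RR_R; split=> [i lei|i lti||].
- by rewrite mem_nth // (count_lower_set RR_R (S_lower lei)).
- rewrite !index_cut_slicing // ?(ltnW lti) //; apply: sub_count => x.
  exact/subsetP/S_sub.
- have [a [q [-> _ _ _ _]]] := linkage_path_shape card_AB RR_link RR_R.
  rewrite /cut_slicing S0 (eq_count (a2 := pred0)) ?count_pred0 // => x /=.
  by rewrite inE.
- have [a [q [eqR _ uniqR _ RB]]] := linkage_path_shape card_AB RR_link RR_R.
  rewrite eqR in RB *; rewrite /= [in RHS]/cut_slicing SM count_all_but_last //.
    by rewrite -last_nth.
  by move=> x xR /=; rewrite inE RB.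
Qed.

Lemma mem_sigma_cut_slicing i R x : 0 < i <= M -> R \in RR -> x \in R ->
  x \in S i -> x \notin S i.-1 -> x \notin cut A s (S i.-1) ->
  x \in sigma cut_slicing i R.
Proof.
case: i => // i /= lti RR_R xR xSi1 xSi.
rewrite !inE (negbTE xSi) /= negb_or => /andP[xA xs].
rewrite mem_filter xR andbT /= !index_cut_slicing // ?(ltnW lti) //.
have lowS := S_lower (ltnW lti).
rewrite (lower_set_prefix RR_R (S_lower lti)) // xSi1 andbT.
rewrite ltn_neqAle [X in _ && X]leqNgt (lower_set_prefix RR_R lowS) // xSi andbT.
apply/eqP => eq_count.
have [a [q [eqR _ uniqR RA _]]] := linkage_path_shape card_AB RR_link RR_R.
have def_x := nth_index a xR; rewrite -eq_count in def_x.
have ltc := count_lower_set RR_R lowS; rewrite eqR in RR_R RA ltc def_x eq_count xR.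
(* Now [x] would be the first vertex of [R] outside of [S i]: either the start, in [A], or the
   successor of a vertex of [S i]. Both are excluded by avoiding the cut. *)
case def_c: (count _ _) => [|c] in ltc def_x eq_count.
  by rewrite RA // -def_x eqxx in xA.
case/imsetP: xs; exists (nth a (a :: q) c); last first.
  by rewrite (successor_nth card_AB RR_link RR_R) // -def_x.
have inR : nth a (a :: q) c \in a :: q by rewrite mem_nth // ltnW.
by rewrite -(lower_set_prefix RR_R lowS) // def_c index_uniq // ltnW.
Qed.

Definition within (QQ : {fset seq T}) (U : {set T}) : {fset seq T} :=
  [fset Q in QQ | all [in U] Q].

(** A path inside [S i] meets the cut of [S i.-1], lies within [S i.-1], or avoids both sets and
    belongs to the slice. *)
Lemma slice_cut_slicing QQ i : 0 < i <= M -> node_disjoint_paths e QQ ->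
  #|` within QQ (S i)| <=
    #|` slice RR cut_slicing QQ i| + #|` within QQ (S i.-1)| + #|A|.
Proof.
move=> ltiM QQ_disj; have lowS : lower_set e B s (S i.-1).
  by apply: S_lower; case: i ltiM => // i /ltnW.
have s_inj := successor_inj card_AB RR_link.
have sB := successor_startE card_AB RR_link.
have touching := card_touching (cut A s (S i.-1)) QQ_disj.
apply: leq_trans (leq_add (leqnn _) (leq_trans touching (card_cut s_inj sB lowS))).
set X := slice _ _ _ _; set Y := within _ (S i.-1); set Z := [fset _ in _ | _].
have sub : within QQ (S i) `<=` (X `|` Y) `|` Z.
  apply/fsubsetP => Q; rewrite !inE /= => /andP[QQ_Q QSi]; rewrite QQ_Q /=.
  case: (boolP (has _ Q)) => [|Qcut]; rewrite ?orbT // orbF.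
  case: (boolP (all _ Q)) => [|QS]; rewrite ?orbT // orbF.
  have Qout : ~~ has [in S i.-1] Q.
    apply: contra QS; apply: (path_misses_cut (A := A)) lowS _ Qcut => //.
    exact: QQ_disj.1.
  apply/subsetP => x; rewrite !inE => /andP[xQ _].
  have [RRx xx] := mem_path_through RR_link x.
  apply/mem_vertices_of; exists (sigma cut_slicing i (path_through RR x)).
    by apply/imfsetP; exists (path_through RR x).
  apply: mem_sigma_cut_slicing => //; first exact: (allP QSi).
    by apply: contra Qout => xS; apply/hasP; exists x.
  by apply: contra Qcut => xS; apply/hasP; exists x.
apply: leq_trans (fsubset_leq_card sub) _.
apply: leq_trans (leq_card_fsetU _ _).1 _.
by rewrite leq_add2r (leq_card_fsetU _ _).1.
Qed.

End CutSlicing.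

(** * Counting enclosed paths and choosing the chain *)

Lemma within_step (T : finType) (e : rel T) (QQ : {fset seq T}) (U : {set T}) x :
  node_disjoint_paths e QQ -> #|` within QQ (x |: U)| <= #|` within QQ U|.+1.
Proof.
move=> QQ_disj.
(* Only the path through [x] can be new; if there is none, the dummy [[::]] merely enlarges the
   bound. *)
have sub : within QQ (x |: U) `<=` path_through QQ x |` within QQ U.
  apply/fsubsetP => Q; rewrite !inE /= => /andP[QQ_Q /allP QxU].
  case: (boolP (x \in Q)) => [xQ | xQ].
    by rewrite (path_throughE QQ_disj QQ_Q xQ) eqxx.
  rewrite QQ_Q; apply/orP; right; apply/allP => y yQ /=.
  have := QxU y yQ; rewrite /= !inE => /predU1P[eq_yx|//].
  by rewrite -eq_yx yQ in xQ.
apply: leq_trans (fsubset_leq_card sub) _.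
by rewrite cardfsU1; case: (_ \notin _).
Qed.

Lemma within_set0 (T : finType) (e : rel T) (QQ : {fset seq T}) :
  node_disjoint_paths e QQ -> #|` within QQ set0| = 0.
Proof.
move=> QQ_disj; apply/eqP; rewrite cardfs_eq0; apply/eqP/fsetP => Q.
rewrite !inE /=; apply/negP => /andP[/QQ_disj.1].
by case: Q => //= x q _; rewrite inE.
Qed.

Lemma leq_width (T : finType) M (RR : {fset seq T}) v QQ w : 0 < M ->
  (forall i, 0 < i <= M -> w <= #|` slice RR v QQ i|) -> w <= width M RR v QQ.
Proof.
move=> M_gt0 le_w; rewrite /width big_seq.
elim/big_ind: _ => [|m n le_m le_n|i]; last by rewrite mem_index_iota ltnS => /le_w.
(* The default value of the minimum is bounded through slice 1, a subset of [QQ]. *)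
- apply: leq_trans (le_w 1 _) _; first by rewrite M_gt0.
  by apply: fsubset_leq_card; apply/fsubsetP => Q; rewrite inE => /andP[].
- by rewrite leq_min le_m.
Qed.

Theorem theorem4p8 (T : finType) (e : rel T)
  (e_sym : symmetric e) (e_irr : irreflexive e)
  (A B : {set T}) (N : nat) (N_gt0 : 0 < N) (cardA : #|A| = N) (cardB : #|B| = N)
  (RR : {fset seq T}) (RR_link : perfect_unique_linkage e A B RR)
  (QQ : {fset seq T}) (QQ_disj : node_disjoint_paths e QQ)
  (QQ_int : {in QQ, forall Q, exists2 R, R \in RR & intersects Q R})
  (M w : nat) (M_gt0 : 0 < M) (w_gt0 : 0 < w)
  (QQ_large : M * w + M.+1 * N <= #|` QQ|) :
  exists v : seq T -> nat -> T, is_slicing M RR v /\ w <= width M RR v QQ.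
Proof.
have card_AB : #|A| = #|B| by rewrite cardA cardB.
have s_inj := successor_inj card_AB RR_link.
have sB := successor_startE card_AB RR_link.
have s_edge := successor_edge card_AB RR_link.
have s_unique := successor_unique card_AB RR_link.
set s := successor RR in s_inj sB s_edge s_unique.
have [x0 _] : exists x, x \in A by apply/set0Pn; rewrite -card_gt0 cardA.
(* At most [N] paths touch [B], which uses up one of the [M.+1] summands [N]. *)
have large : M * (w + N) <= #|` within QQ (~: B)|.
  have := card_touching B QQ_disj; rewrite cardB => touching.
  have sub : QQ `<=` within QQ (~: B) `|` [fset Q in QQ | has [in B] Q].
    apply/fsubsetP => Q QQ_Q; rewrite !inE /= QQ_Q /= -(negbK (has _ _)) -all_predC.
    by rewrite (eq_all (a2 := predC [in B])) ?orbN // => x /=; rewrite inE.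
  have := leq_trans (fsubset_leq_card sub) (leq_card_fsetU _ _).1; nia.
have chain m : m <= M -> exists S : nat -> {set T},
    [/\ S 0 = set0, forall i, i < m -> S i \subset S i.+1,
        forall i, i <= m -> lower_set e B s (S i) &
        forall i, i <= m -> #|` within QQ (S i)| = i * (w + N)].
  elim: m => [_|m IH ltm].
    exists (fun=> set0); split=> // [i|i]; first by move=> _; apply: lower_set0.
    by rewrite leqn0 => /eqP ->; rewrite (within_set0 QQ_disj).
  have [S [S0 S_sub S_low S_card]] := IH (ltnW ltm).
  have step (U : {set T}) x : x \notin U ->
      #|` within QQ (x |: U)| <= #|` within QQ U|.+1.
    by move=> _; apply: within_step QQ_disj.
  have [||S' [lowS' sub_S' card_S']] :=
    @lower_set_interpolation _ e A B s s_inj sB s_edge s_unique _ step (S m) (m.+1 * (w + N)).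
  - exact: S_low.
  - rewrite S_card // leq_mul2r leqnSn orbT /=.
    by apply: leq_trans large; rewrite leq_mul2r ltm orbT.
  exists (fun i => if i <= m then S i else S'); split=> // i.
  - rewrite ltnS => lei; rewrite lei; case: ltnP => [/S_sub //|gei].
    by have -> : i = m by apply/eqP; rewrite eqn_leq lei.
  - by case: ifP => [/S_low //|].
  - case: (leqP i m) => [lei _ | gti lei]; first exact: S_card.
    by rewrite card_S'; congr (_ * _); lia.
have [S [S0 S_sub S_low S_card]] := chain M (leqnn M).
(* The top of the chain may be smaller than [~: B]. Replacing it makes the slicing end at the last
   vertices, and by [large] its count is still at least [M * (w + N)]. *)
pose S' i := if i < M then S i else ~: B.
have S'_low i : i <= M -> lower_set e B s (S' i).
  by move=> lei; rewrite /S'; case: ifP => _; [apply: S_low | apply: lower_setC].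
have S'0 : S' 0 = set0 by rewrite /S' M_gt0.
have S'M : S' M = ~: B by rewrite /S' ltnn.
have S'_sub i : i < M -> S' i \subset S' i.+1.
  move=> lti; rewrite {1}/S' lti /S'; case: ifP => _; first exact: S_sub.
  by case: (S_low i (ltnW lti)).
exists (cut_slicing S' x0); split.
  exact: (cut_slicingP card_AB RR_link x0 S'_low S'0 S'M S'_sub).
apply: leq_width => // i lti.
have := slice_cut_slicing e_sym card_AB RR_link x0 S'_low lti QQ_disj.
have -> : #|` within QQ (S' i.-1)| = i.-1 * (w + N).
  by rewrite /S'; case: ifP => [ltiM|]; [apply: S_card; apply: ltnW | lia].
have : i * (w + N) <= #|` within QQ (S' i)|.
  rewrite /S'; case: ltnP => [/ltnW /S_card -> // | geM].
  by have -> : i = M by lia.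
(* Consecutive counts differ by at least [w + N], and the cut costs at most [N]. *)
rewrite cardA; case: i lti => // i _ /=; nia.
Qed.
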